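(* Let $d=k=1$. Assume: 1. there are $\alpha\in(0,1]$ and a function $c:E\to\mathbb R$ with $\|c\|_{\mu_\theta}<\infty$ for all $\theta\in\Theta$ such that $|\partial_\theta r(x,\theta')-\partial_\theta r(x,\theta)|\le c(x)\,|\theta'-\theta|^\alpha$ for all $x\in E$ and all $\theta,\theta'\in\Theta$; 2. $\widehat\theta_T$ is an estimator of $\theta$ based on $X_{(T)}$ such that for all $\theta\in\Theta$ the limit $V(\theta)=\lim_{T\to\infty}T\,\mathrm E_\theta(\widehat\theta_T-\theta)^2$ exists (and is finite); 3. $T\,\mathrm E_\theta|\widehat\theta_T-\theta|^{2+2\alpha}=o(1)$ as $T\to\infty$, for all $\theta\in\Theta$. Then for all $\theta\in\Theta$, $$\lim_{T\to\infty}T\rho_T(\theta)=\|\partial_\theta r(\cdot,\theta)\|_{\mu_\theta}^2\,V(\theta).$$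
   Context: Setting (univariate case). $(X_t,\ t\ge0)$ (time set $\mathbb N$ or $\mathbb R_+$) is a random process with values in a measurable space $(E,\mathcal B)$, with distribution $\mathrm P_\theta$, $\theta\in\Theta\subset\mathbb R$; $X_{(T)}=(X_t,\ 0\le t\le T)$. $(Y_t)$ is a real process and $r(x,\theta)=\mathrm E_\theta(Y_T\mid X_T=x)\in\mathbb R$, assumed not to depend on $T$, is measurable in $(x,\theta)$ and differentiable in $\theta$ on $\Theta$. $\mu_\theta$ is the distribution of $X_T$ under $\mathrm P_\theta$, assumed not to depend on $T$; $r(\cdot,\theta)$ and $\partial_\theta r(\cdot,\theta)$ are in $\mathrm L^2(\mu_\theta)$. For a function $f$ on $E$, $\|f\|_{\mu_\theta}^2=\int_E|f(x)|^2d\mu_\theta(x)$. The quadratic error of estimation of the regression function by the plug-in estimator $r(\cdot,\widehat\theta_T)$ is $\rho_T(\theta)=\int_E\mathrm E_\theta\big(r(x,\widehat\theta_T)-r(x,\theta)\big)^2d\mu_\theta(x)$.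
   Formalization: Θ is assumed to be an interval; for disconnected Θ the claim can fail, since r may jump between components to a function not in L²(μ_θ), making ρ_T(θ) infinite. Derivatives in θ are taken within Θ (one-sided at endpoints). *)

(* Defs.v *)
From HB Require Import structures.
From mathcomp Require Export all_boot all_order all_algebra.
From mathcomp Require Export all_classical all_reals all_analysis.
Export Order.TTheory GRing.Theory Num.Theory.
Export numFieldNormedType.Exports.

Set Implicit Arguments.
Unset Strict Implicit.
Unset Printing Implicit Defensive.

Local Open Scope classical_set_scope.
Local Open Scope ring_scope.

Variant time_kind := DiscreteTime | ContinuousTime.

(* Both time domains are viewed inside R, so that processes are indexed by R;
   only their values at times of the domain are ever constrained. *)
Definition time_set (R : realType) (k : time_kind) : set R :=
  match k with
  | DiscreteTime => range (fun n : nat => n%:R)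
  | ContinuousTime => [set t | 0 <= t]
  end.
Arguments time_set : clear implicits.

Definition time_infty (R : realType) (k : time_kind) : set_system R :=
  within (time_set R k) (pinfty_nbhs R).
Arguments time_infty : clear implicits.

(* The sigma-algebra generated by X_(T) = (X_t, 0 <= t <= T). *)
Definition history (R : realType) (k : time_kind) dW dE
    (W : measurableType dW) (E : measurableType dE) (X : R -> W -> E) (T : R)
    : set_system W :=
  <<s \bigcup_(t in time_set R k `&` [set t | t <= T])
        preimage_set_system setT (X t) measurable >>.

(* theta_T is a Theta-valued statistic which is sigma(X_(T))-measurable. *)
Definition estimator_based_on (R : realType) (k : time_kind) dW dE
    (W : measurableType dW) (E : measurableType dE) (Theta : set R)
    (X : R -> W -> E) (T : R) (thetaT : W -> R) : Prop :=
  (forall w, Theta (thetaT w)) /\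
  (forall B : set R, measurable B -> history k X T (thetaT @^-1` B)).

(* f is a version of x |-> E(Y | X = x), i.e. f(X) = E(Y | sigma(X)) a.s. *)
Definition is_regression_function (R : realType) dW dE
    (W : measurableType dW) (E : measurableType dE)
    (P : probability W R) (Y : W -> R) (X : W -> E) (f : E -> R) : Prop :=
  [/\ P.-integrable setT (EFin \o Y),
      measurable_fun setT f,
      P.-integrable setT (EFin \o (f \o X)) &
      forall B : set E, measurable B ->
        (\int[P]_(w in X @^-1` B) (Y w)%:E =
         \int[P]_(w in X @^-1` B) (f (X w))%:E)%E].

(* Differentiation relative to Theta: increments stay inside Theta, hence this
   is the usual derivative at interior points, one-sided at endpoints. *)
Definition derivable_in (R : realType) (Theta : set R) (f : R -> R) (a : R) :
    Prop :=
  cvg ((f b - f a) / (b - a) @[b --> within Theta a^']).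

Definition derive_in (R : realType) (Theta : set R) (f : R -> R) (a : R) : R :=
  lim ((f b - f a) / (b - a) @[b --> within Theta a^']).

Definition plugin_error (R : realType) dW dE
    (W : measurableType dW) (E : measurableType dE)
    (P : probability W R) (mu : probability E R) (r : E -> R -> R)
    (thetaT : W -> R) (theta : R) : \bar R :=
  (\int[mu]_x 'E_P[(fun w => ((r x (thetaT w) - r x theta) ^+ 2)%R)])%E.

(* Main.v *)
Require Import Defs.
From mathcomp Require Import measurable_realfun.
From mathcomp Require Import ring lra.

(* Write D for the estimation error and g for the derivative of r in theta.
   By the mean value theorem, r(x, theta + D) - r(x, theta) = g(x) D + R(x, D)
   with |R| <= c(x) |D|^(1 + alpha).  Integrating over the product space, the
   main term contributes exactly ||g||^2 E D^2 and the remainder at most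
   ||c||^2 E |D|^(2 + 2 alpha).  Instead of bounding the cross term by
   Cauchy-Schwarz, Young's inequality
   u^2 <= (1 + e) v^2 + (1 + 1/e) (u - v)^2 is used in both directions: the
   error and its main term dominate each other up to a factor 1 + e and a
   multiple of the remainder, and e is arbitrary. *)

Set Implicit Arguments.
Unset Strict Implicit.
Unset Printing Implicit Defensive.

Local Open Scope classical_set_scope.
Local Open Scope ring_scope.

(** * Calculus relative to an interval: mean value theorem and first-order Taylor bound *)

Lemma is_derive_in_interior (R : realType) (Theta : set R) (f : R -> R)
    (a : R) :
  nbhs a Theta -> derivable_in Theta f a ->
  is_derive a 1 f (derive_in Theta f a).
Proof.
move=> aTheta df.
(* Since [Theta] is a neighbourhood of [a], small shifts of [a] stay in [Theta], so the relative
   limit yields the ordinary one. *)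
have shiftP : h + a @[h --> 0^'] --> within Theta a^'.
  move=> A; rewrite /within /dnbhs /= => HA.
  have : h + a @[h --> (0 : R)] --> 0 + a.
    by apply: cvgD; [exact: cvg_id|exact: cvg_cst].
  rewrite add0r => /(_ _ (filterI aTheta HA)) aTA.
  apply: (@filterS _ (nbhs (0 : R))) aTA => h /= [Th Ah] h0.
  by apply: Ah => //; apply: contra_neq h0 => /(canRL (addrK a)); rewrite subrr.
have dfl : h^-1 *: ((f \o shift a) (h *: 1) - f a) @[h --> 0^']
    --> derive_in Theta f a.
  rewrite (_ : (fun h => _) =
    (fun b => (f b - f a) / (b - a)) \o (fun h => h + a)); last first.
    by apply/funext => h /=; rewrite [h *: 1]mulr1 addrK mulrC.
  exact: cvg_comp shiftP df.
by split; [apply/cvg_ex; exists (derive_in Theta f a)|exact: cvg_lim dfl].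
Qed.

Lemma derivable_in_continuous (R : realType) (Theta : set R) (f : R -> R) :
  (forall a, Theta a -> derivable_in Theta f a) -> {within Theta, continuous f}.
Proof.
move=> df; apply/subspace_continuousP => a Ta.
(* For [b != a] this expression is just [f b]. At [b = a] the quotient divides by zero, so that
   point is treated separately at the end. *)
have H : f a + (f b - f a) / (b - a) * (b - a) @[b --> within Theta a^']
    --> f a + derive_in Theta f a * (a - a).
  apply: cvgD; first exact: cvg_cst.
  apply: cvgM; first exact: df.
  apply: cvgB; last exact: cvg_cst.
  by apply: cvg_within_filter; apply: cvg_within_filter; exact: cvg_id.
rewrite subrr mulr0 addr0 in H.
move=> A /[dup] /nbhs_singleton Afa /H.
rewrite /within /dnbhs /= => HA.
apply: (@filterS _ (nbhs a)) HA => b /= Ab Tb.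
have [->//|ba] := eqVneq b a.
by have := Ab ba Tb; rewrite divfK ?subr_eq0// addrC subrK.
Qed.

(** The open segment between two points of [Theta] is interior to [Theta], where the relative
    derivative is the usual one. At the ends of the segment continuity suffices, so endpoints of
    [Theta] are allowed. The weak bound on [xi] covers both orders of [a] and [b] as well as
    [a = b]. *)
Lemma MVT_in (R : realType) (Theta : set R) (f : R -> R) (a b : R) :
  is_interval Theta -> (forall t, Theta t -> derivable_in Theta f t) ->
  Theta a -> Theta b ->
  exists xi, [/\ Theta xi, `|xi - a| <= `|b - a| &
    f b - f a = derive_in Theta f xi * (b - a)].
Proof.
move=> iT df.
have cf := derivable_in_continuous df.
suff main u v : Theta u -> Theta v -> u < v -> exists xi,
    [/\ Theta xi, u < xi < v & f v - f u = derive_in Theta f xi * (v - u)].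
  move=> Ta Tb; have [ab|ba|->] := ltgtP a b.
  - have [xi [Txi /andP[axi xib] fE]] := main _ _ Ta Tb ab.
    by exists xi; split => //; rewrite !ger0_norm; lra.
  - have [xi [Txi /andP[bxi xia] fE]] := main _ _ Tb Ta ba.
    exists xi; split => //; first by rewrite !ler0_norm; lra.
    by rewrite -opprB fE -mulrN opprB.
  - by exists b; split => //; rewrite !subrr mulr0.
move=> Tu Tv uv.
have uvT : `[u, v] `<=` Theta by move=> x /=; rewrite in_itv/=; exact: iT.
have [|xi + fE] := @MVT R f (derive_in Theta f) u v uv _
  (continuous_subspaceW uvT cf).
  move=> x xuv; have uvT' : `]u, v[ `<=` Theta.
    by move=> y /subset_itv_oo_cc /uvT.
  apply: is_derive_in_interior; last exact/df/uvT'.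
  by apply: filterS uvT' _; exact: near_in_itvoo.
rewrite in_itv/= => /andP[uxi xiv]; exists xi; split; rewrite ?uxi//.
by apply: uvT; rewrite /= in_itv/= !ltW.
Qed.

(* No sign is assumed on [c]: Hölder continuity forces [0 <= c] unless [Theta]
   is a single point. *)
Lemma taylor1_holder (R : realType) (Theta : set R) (f : R -> R)
    (alpha c a b : R) :
  is_interval Theta -> (forall t, Theta t -> derivable_in Theta f t) ->
  0 < alpha ->
  (forall s t, Theta s -> Theta t ->
    `|derive_in Theta f t - derive_in Theta f s| <= c * `|t - s| `^ alpha) ->
  Theta a -> Theta b ->
  (f b - f a - derive_in Theta f a * (b - a)) ^+ 2
    <= c ^+ 2 * `|b - a| `^ (2 + 2 * alpha).
Proof.
move=> iT df alpha0 hf Ta Tb.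
have [->|ba] := eqVneq b a.
  by rewrite !subrr mulr0 subrr expr0n/= mulr_ge0// ?sqr_ge0// powR_ge0.
have nba : 0 < `|b - a| by rewrite normr_gt0 subr_eq0.
have [xi [Txi xiab ->]] := MVT_in iT df Ta Tb.
have c0 : 0 <= c.
  have := le_trans (normr_ge0 _) (hf _ _ Ta Tb).
  by rewrite pmulr_lge0// powR_gt0.
have -> : `|b - a| `^ (2 + 2 * alpha) = (`|b - a| * `|b - a| `^ alpha) ^+ 2.
  rewrite powRD; last by apply/implyP => _; rewrite gt_eqF.
  by rewrite (mulrC 2 alpha) powRrM !powR_mulrn ?powR_ge0// exprMn.
(* The remainder is now the increment of the derivative from [a] to [xi], times [b - a]. Comparing
   square roots leaves the Hölder bound at [xi], which is at most as far from [a] as [b] is. *)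
rewrite -exprMn -mulrBl -[leLHS]real_normK ?num_real//.
rewrite ler_pXn2r ?nnegrE// ?mulr_ge0// ?powR_ge0//.
rewrite normrM [leRHS]mulrCA mulrC ler_wpM2l//.
apply: (le_trans (hf _ _ Ta Txi)); rewrite ler_wpM2l// ge0_ler_powR ?nnegrE//.
exact: ltW.
Qed.

(** * Young's inequality, pointwise and integrated, and integrals of products *)

Lemma sqr_le_young (R : realFieldType) (e u v : R) : 0 < e ->
  u ^+ 2 <= (1 + e) * v ^+ 2 + (1 + e^-1) * (u - v) ^+ 2.
Proof.
move=> e0; rewrite -subr_ge0.
rewrite (_ : _ - _ = e^-1 * (e * v - (u - v)) ^+ 2); last first.
  by field; rewrite gt_eqF.
by rewrite mulr_ge0 ?sqr_ge0// invr_ge0 ltW.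
Qed.

(** All integrands are nonnegative, so the pointwise inequality integrates in the extended reals,
    where either side may be infinite. *)
Lemma integral_sqr_young (R : realType) d (T : measurableType d)
    (m : {measure set T -> \bar R}) (u v w : T -> R) (e : R) :
  measurable_fun setT u -> measurable_fun setT v -> measurable_fun setT w ->
  (forall x, (u x - v x) ^+ 2 <= w x) -> 0 < e ->
  (\int[m]_x (u x ^+ 2)%:E <=
    (1 + e)%:E * \int[m]_x (v x ^+ 2)%:E +
    (1 + e^-1)%:E * \int[m]_x (w x)%:E)%E.
Proof.
move=> mu mv mw uvw e0.
have e0' : 0 <= 1 + e by lra.
have e1 : 0 <= 1 + e^-1 by rewrite addr_ge0 ?invr_ge0// ltW.
have w0 x : 0 <= w x := le_trans (sqr_ge0 _) (uvw x).
rewrite -!ge0_integralZl_EFin//=; last 4 first.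
- by move=> x _; rewrite lee_fin w0.
- exact/measurable_EFinP.
- by move=> x _; rewrite lee_fin sqr_ge0.
- by apply/measurable_EFinP; exact: measurable_funX.
rewrite -ge0_integralD//=; last 4 first.
- by move=> x _; rewrite lee_fin mulr_ge0// sqr_ge0.
- apply/measurable_EFinP; apply: measurable_funM => //.
  exact: measurable_funX.
- by move=> x _; rewrite lee_fin mulr_ge0// w0.
- by apply/measurable_EFinP; exact: measurable_funM.
apply: ge0_le_integral => //=.
- by move=> x _; rewrite lee_fin sqr_ge0.
- by apply/measurable_EFinP; exact: measurable_funX.
- apply/measurable_EFinP/measurable_funD; apply: measurable_funM => //.
  exact: measurable_funX.
move=> x _; rewrite lee_fin; apply: le_trans (sqr_le_young _ (v x) e0) _.
by rewrite lerD2l ler_wpM2l.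
Qed.

Lemma ge0_integral_prod (R : realType) d1 d2 (T1 : measurableType d1)
    (T2 : measurableType d2) (m1 : {sigma_finite_measure set T1 -> \bar R})
    (m2 : {sigma_finite_measure set T2 -> \bar R}) (f : T1 -> R) (g : T2 -> R) :
  measurable_fun setT f -> measurable_fun setT g ->
  (forall x, 0 <= f x) -> (forall y, 0 <= g y) ->
  (\int[m1 \x m2]_z (f z.1 * g z.2)%:E =
   (\int[m1]_x (f x)%:E) * \int[m2]_y (g y)%:E)%E.
Proof.
move=> mf mg f0 g0; rewrite fubini_tonelli1//=; last 2 first.
- apply/measurable_EFinP; apply: measurable_funM.
  + exact: measurableT_comp.
  + exact: measurableT_comp.
- by move=> z; rewrite lee_fin mulr_ge0.
rewrite -ge0_integralZr//=; last 3 first.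
- exact/measurable_EFinP.
- by move=> x _; rewrite lee_fin.
- by apply: integral_ge0 => y _; rewrite lee_fin.
apply: eq_integral => x _; rewrite /fubini_F/=.
rewrite -ge0_integralZl_EFin//; last exact/measurable_EFinP.
by move=> y _; rewrite lee_fin.
Qed.

(** * Limits under two-sided Young bounds *)

Lemma cvg_young (R : realType) (I : Type) (F : set_system I) (FF : Filter F)
    (p q s : I -> R) (l : R) :
  (\forall i \near F, 0 <= p i /\ forall e, 0 < e ->
    p i <= (1 + e) * q i + (1 + e^-1) * s i /\
    q i <= (1 + e) * p i + (1 + e^-1) * s i) ->
  q @ F --> l -> s @ F --> 0 -> p @ F --> l.
Proof.
move=> H ql s0; apply/cvgrPdist_le => e e0.
pose M := `|l| + 1; have M0 : 0 < M by rewrite /M; have := normr_ge0 l; lra.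
(* This choice gives both [eps <= 1] and [eps * M <= e / 8], where [M] will eventually bound [q].
   The weight [K] of [s] is then fixed, so [s] can be made small relative to it. *)
pose eps := e / (8 * M + e).
have eps0 : 0 < eps by rewrite divr_gt0//; nra.
have eps1 : eps <= 1 by rewrite ler_pdivrMr; nra.
have epsM : eps * M <= e / 8.
  rewrite /eps mulrAC ler_pdivrMr; last nra.
  by have := mulr_ge0 (ltW e0) (ltW e0); nra.
pose K := 1 + eps^-1; have K0 : 0 < K by rewrite addr_gt0 ?invr_gt0.
have d0 : 0 < e / (8 * K) by rewrite divr_gt0//; nra.
near=> i.
have [p0 /(_ _ eps0) []] : 0 <= p i /\ forall e, 0 < e ->
    p i <= (1 + e) * q i + (1 + e^-1) * s i /\
    q i <= (1 + e) * p i + (1 + e^-1) * s i by near: i.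
rewrite -/K => pq qp.
have lq : `|l - q i| <= e / 4 by near: i; apply: cvgr_dist_le => //; lra.
have lq1 : `|l - q i| <= 1 by near: i; apply: cvgr_dist_le => //; lra.
have sK : K * s i <= e / 8.
  have : `|0 - s i| <= e / (8 * K) by near: i; apply: cvgr_dist_le.
  rewrite sub0r normrN => /(le_trans (ler_norm _)).
  rewrite invfM mulrA ler_pdivlMr// mulrC; lra.
have qM : q i <= M.
  by move: lq1; rewrite ler_norml /M => /andP[+ _]; have := ler_norm l; lra.
have epsq : eps * q i <= e / 8.
  by rewrite (le_trans _ epsM)// ler_pM2l.
(* No bound on [p] is given in advance: the first inequality, multiplied by [eps], bounds
   [eps * p i] by three terms of size at most [e / 8]. *)
have epsp : eps * p i <= e / 2.
  have := ler_wpM2l (ltW eps0) pq.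
  have : eps * (e / 8) <= e / 8 by nra.
  have : eps * (eps * q i) <= eps * (e / 8) by rewrite ler_pM2l.
  have : eps * (K * s i) <= eps * (e / 8) by rewrite ler_pM2l.
  lra.
move: lq; rewrite !ler_norml => /andP[? ?]; apply/andP; split; lra.
Unshelve. all: by end_near.
Qed.

(** Finite limits make [q] and [s] eventually finite. The first inequality with [e = 1] passes this
    on to [p], which reduces the claim to real values. *)
Lemma cvge_young (R : realType) (I : Type) (F : set_system I) (FF : Filter F)
    (p q s : I -> \bar R) (l : R) :
  (\forall i \near F, (0 <= p i)%E /\ forall e : R, 0 < e ->
    (p i <= (1 + e)%:E * q i + (1 + e^-1)%:E * s i)%E /\
    (q i <= (1 + e)%:E * p i + (1 + e^-1)%:E * s i)%E) ->
  q @ F --> l%:E -> s @ F --> 0%E -> p @ F --> l%:E.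
Proof.
move=> H /fine_cvgP[qfin ql] /fine_cvgP[sfin s0].
have pfin : \forall i \near F, p i \is a fin_num.
  near=> i.
  have qi : q i \is a fin_num by near: i.
  have si : s i \is a fin_num by near: i.
  have [p0 /(_ _ ltr01) [pq _]] : (0 <= p i)%E /\ forall e : R, 0 < e ->
    (p i <= (1 + e)%:E * q i + (1 + e^-1)%:E * s i)%E /\
    (q i <= (1 + e)%:E * p i + (1 + e^-1)%:E * s i)%E by near: i.
  rewrite ge0_fin_numE// (le_lt_trans pq)// -(fineK qi) -(fineK si).
  by rewrite -!EFinM -EFinD ltry.
apply/fine_cvgP; split => //.
apply: (cvg_young FF _ ql s0); near=> i.
have qi : q i \is a fin_num by near: i.
have si : s i \is a fin_num by near: i.
have pi : p i \is a fin_num by near: i.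
have [p0 pq] : (0 <= p i)%E /\ forall e : R, 0 < e ->
    (p i <= (1 + e)%:E * q i + (1 + e^-1)%:E * s i)%E /\
    (q i <= (1 + e)%:E * p i + (1 + e^-1)%:E * s i)%E by near: i.
split => [|e /pq]; first exact: fine_ge0.
rewrite -[X in (X <= _)%E /\ _](fineK pi) -[X in _ /\ (X <= _)%E](fineK qi).
rewrite -(fineK pi) -(fineK qi) -(fineK si).
by rewrite -!EFinM -!EFinD !lee_fin.
Unshelve. all: by end_near.
Qed.

(** * Squared norms and measurability of the estimator *)

Lemma Lnorm2_sqr (R : realType) d (T : measurableType d)
    (m : {measure set T -> \bar R}) (f : T -> R) :
  ('N[m]_2%:E[EFin \o f] ^+ 2 = \int[m]_x (f x ^+ 2)%:E)%E.
Proof.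
transitivity ('N[m]_2%:E[EFin \o f] `^ 2)%E.
  have := Lnorm_ge0 m 2%:E (EFin \o f).
  case: ('N[m]_2%:E[EFin \o f])%E => [x|_|//].
  - by rewrite lee_fin => x0; rewrite poweR_EFin powR_mulrn// EFin_expe.
  - by rewrite expe2 mulyy poweRyr.
rewrite poweR_Lnorm//; apply: eq_integral => x _ /=.
by rewrite powR_mulrn// real_normK ?num_real.
Qed.

(** The generators of [history] are preimages under measurable maps [X t], so the sigma-algebra they
    generate lies inside that of [W]. *)
Lemma estimator_measurable (R : realType) (k : time_kind) dW dE
    (W : measurableType dW) (E : measurableType dE) (Theta : set R)
    (X : R -> W -> E) (T : R) (thetaT : W -> R) :
  (forall t, time_set R k t -> measurable_fun setT (X t)) ->
  estimator_based_on k Theta X T thetaT -> measurable_fun setT thetaT.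
Proof.
move=> mX [_ mth] _ B mB; rewrite setTI.
move: (mth _ mB); apply: smallest_sub; first exact: sigma_algebra_measurable.
move=> A [t [kt _]] [C mC <-]; exact: mX.
Qed.

(** * Expansion of the error on the product space at a fixed time *)

Section plugin_error_expansion.
Context (R : realType) (dW dE : measure_display) (W : measurableType dW)
  (E : measurableType dE) (Theta : set R) (P : probability W R)
  (mu : probability E R) (r : E -> R -> R) (alpha theta : R) (c : E -> R)
  (th : W -> R).
Hypothesis iTheta : is_interval Theta.
Hypothesis mr : measurable_fun (setT `*` Theta) (fun z : E * R => r z.1 z.2).
Hypothesis dr : forall x t, Theta t -> derivable_in Theta (r x) t.
Hypothesis alpha0 : 0 < alpha.
Hypothesis holder : forall x s t, Theta s -> Theta t ->
  `|derive_in Theta (r x) t - derive_in Theta (r x) s|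
    <= c x * `|t - s| `^ alpha.
Hypothesis mc : measurable_fun setT c.
Hypothesis mdr : measurable_fun setT (fun x => derive_in Theta (r x) theta).
Hypothesis Theta_theta : Theta theta.
Hypothesis Theta_th : forall w, Theta (th w).
Hypothesis mth : measurable_fun setT th.

Lemma measurable_plugin t : Theta t -> measurable_fun setT (r ^~ t).
Proof.
move=> Tt.
apply: (@measurable_comp _ _ _ _ _ _ (setT `*` Theta) _ _
  (fun x => (x, t)) _ _ mr).
- by apply: measurableX => //; exact: is_interval_measurable.
- by move=> _ [x _ <-]; split.
- exact: measurable_fun_pair.
Qed.

(** [r] is jointly measurable only over [Theta], so the composition relies on [th] taking its values
    there and on intervals being Borel. *)
Lemma measurable_plugin_estimator :
  measurable_fun setT (fun z : E * W => r z.1 (th z.2)).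
Proof.
apply: (@measurable_comp _ _ _ _ _ _ (setT `*` Theta) _ _
  (fun z : E * W => (z.1, th z.2)) _ _ mr).
- by apply: measurableX => //; exact: is_interval_measurable.
- by move=> _ [z _ <-]; split => //=; exact: Theta_th.
- by apply: measurable_fun_pair => //; exact: measurableT_comp.
Qed.

(** [rem] will dominate the square of [F - lin], not [F - lin] itself. [lin] and [rem] separate the
    variables, so the integrals of [lin ^+ 2] and [rem] factor. *)
Let F (z : E * W) := r z.1 (th z.2) - r z.1 theta.
Let lin (z : E * W) := derive_in Theta (r z.1) theta * (th z.2 - theta).
Let rem (z : E * W) := c z.1 ^+ 2 * `|th z.2 - theta| `^ (2 + 2 * alpha).

Let mF : measurable_fun setT F.
Proof.
apply: measurable_funB; first exact: measurable_plugin_estimator.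
exact: (measurableT_comp (measurable_plugin Theta_theta)).
Qed.

Let merr : measurable_fun setT (fun w => th w - theta).
Proof. exact: measurable_funB. Qed.

Let mlin : measurable_fun setT lin.
Proof.
apply: measurable_funM.
- exact: (measurableT_comp mdr).
- exact: (measurableT_comp merr).
Qed.

Let mpow : measurable_fun setT (fun w => `|th w - theta| `^ (2 + 2 * alpha)).
Proof.
apply: (measurableT_comp (@measurable_powR R (2 + 2 * alpha))).
exact: measurableT_comp.
Qed.

Let mrem : measurable_fun setT rem.
Proof.
apply: measurable_funM.
- by apply: measurable_funX; exact: (measurableT_comp mc).
- exact: (measurableT_comp mpow).
Qed.

Let plugin_errorE :
  plugin_error P mu r th theta = (\int[mu \x P]_z (F z ^+ 2)%:E)%E.
Proof.
rewrite fubini_tonelli1//; last 2 first.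
- by apply/measurable_EFinP; exact: measurable_funX.
- by move=> z; rewrite lee_fin sqr_ge0.
by apply: eq_integral => x _; rewrite unlock.
Qed.

Let int_lin : (\int[mu \x P]_z (lin z ^+ 2)%:E =
  \int[mu]_x (derive_in Theta (r x) theta ^+ 2)%:E *
    'E_P[(fun w => ((th w - theta) ^+ 2)%R)])%E.
Proof.
under eq_integral do rewrite exprMn.
rewrite (@ge0_integral_prod _ _ _ _ _ mu P
  (fun x => derive_in Theta (r x) theta ^+ 2) (fun w => (th w - theta) ^+ 2))
  ?[in RHS]unlock//.
- exact: measurable_funX.
- exact: measurable_funX.
- by move=> x; exact: sqr_ge0.
- by move=> x; exact: sqr_ge0.
Qed.

Let int_rem : (\int[mu \x P]_z (rem z)%:E =
  \int[mu]_x (c x ^+ 2)%:E *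
    'E_P[(fun w => `|th w - theta| `^ (2 + 2 * alpha))%R])%E.
Proof.
rewrite (@ge0_integral_prod _ _ _ _ _ mu P (fun x => c x ^+ 2)
  (fun w => `|th w - theta| `^ (2 + 2 * alpha))) ?[in RHS]unlock//.
- exact: measurable_funX.
- by move=> x; exact: sqr_ge0.
Qed.

Lemma plugin_error_young (e : R) : 0 < e ->
  let main := (\int[mu]_x (derive_in Theta (r x) theta ^+ 2)%:E *
    'E_P[(fun w => ((th w - theta) ^+ 2)%R)])%E in
  let rest := (\int[mu]_x (c x ^+ 2)%:E *
    'E_P[(fun w => `|th w - theta| `^ (2 + 2 * alpha))%R])%E in
  (plugin_error P mu r th theta
     <= (1 + e)%:E * main + (1 + e^-1)%:E * rest)%E /\
  (main <= (1 + e)%:E * plugin_error P mu r th theta + (1 + e^-1)%:E * rest)%E.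
Proof.
move=> e0 /=; rewrite plugin_errorE -int_lin -int_rem.
have Flin z : (F z - lin z) ^+ 2 <= rem z.
  exact: (taylor1_holder iTheta (@dr z.1) alpha0 (@holder z.1)).
(* The same [rem] serves both directions because the squared difference is symmetric. *)
split; apply: integral_sqr_young => // z.
by rewrite -sqrrN opprB.
Qed.

End plugin_error_expansion.

(** * Multiplication by [T] and passage to the limit *)

Theorem proposition3p2 (R : realType) (k : time_kind)
    (dW dE : measure_display) (W : measurableType dW) (E : measurableType dE)
    (Theta : set R) (P : R -> probability W R)
    (X : R -> W -> E) (Y : R -> W -> R)
    (mu : R -> probability E R) (r : E -> R -> R)
    (HTheta : is_interval Theta)
    (HX : forall t, time_set R k t -> measurable_fun setT (X t))
    (Hmu : forall theta t, Theta theta -> time_set R k t ->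
       forall B : set E, measurable B -> pushforward (P theta) (X t) B = mu theta B)
    (Hreg : forall theta T, Theta theta -> time_set R k T ->
       is_regression_function (P theta) (Y T) (X T) (r ^~ theta))
    (Hrmeas : measurable_fun (setT `*` Theta) (fun z : E * R => r z.1 z.2))
    (Hrder : forall x theta, Theta theta -> derivable_in Theta (r x) theta)
    (HrL2 : forall theta, Theta theta -> r ^~ theta \in Lfun (mu theta) 2%:E)
    (HdrL2 : forall theta, Theta theta ->
       (fun x => derive_in Theta (r x) theta) \in Lfun (mu theta) 2%:E)
    (alpha : R) (c : E -> R) (Halpha : 0 < alpha <= 1)
    (HcL2 : forall theta, Theta theta -> c \in Lfun (mu theta) 2%:E)
    (Hholder : forall x theta theta', Theta theta -> Theta theta' ->
       `|derive_in Theta (r x) theta' - derive_in Theta (r x) theta|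
         <= c x * `|theta' - theta| `^ alpha)
    (thetahat : R -> W -> R)
    (Hest : forall T, time_set R k T ->
       estimator_based_on k Theta X T (thetahat T))
    (V : R -> R)
    (HV : forall theta, Theta theta ->
       (T%:E * 'E_(P theta)[(fun w => ((thetahat T w - theta) ^+ 2)%R)])%E
         @[T --> time_infty R k] --> (V theta)%:E)
    (Hrem : forall theta, Theta theta ->
       (T%:E * 'E_(P theta)[(fun w => (`|thetahat T w - theta| `^ (2 + 2 * alpha))%R)])%E
         @[T --> time_infty R k] --> 0%E) :
  forall theta, Theta theta ->
    (T%:E * plugin_error (P theta) (mu theta) r (thetahat T) theta)%E
      @[T --> time_infty R k] -->
    ('N[mu theta]_2%:E[EFin \o (fun x => derive_in Theta (r x) theta)] ^+ 2
       * (V theta)%:E)%E.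
Proof.
move=> theta Ttheta.
have /andP[alpha0 _] := Halpha.
have mc : measurable_fun setT c.
  by have /andP[] := HcL2 _ Ttheta; rewrite inE.
have mdr : measurable_fun setT (fun x => derive_in Theta (r x) theta).
  by have /andP[] := HdrL2 _ Ttheta; rewrite inE.
rewrite Lnorm2_sqr.
set G := (\int[mu theta]_x (derive_in Theta (r x) theta ^+ 2)%:E)%E.
pose C := (\int[mu theta]_x (c x ^+ 2)%:E)%E.
(* Finiteness of [G] and [C] makes the limit finite and lets them multiply the convergent factors
   below. *)
have Gfin : G \is a fin_num.
  apply: integrable_fin_num => //.
  exact: Lfun2_integrable_sqr (HdrL2 _ Ttheta).
have Cfin : C \is a fin_num.
  apply: integrable_fin_num => //.
  exact: Lfun2_integrable_sqr (HcL2 _ Ttheta).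
have G0 : (0 <= G)%E by apply: integral_ge0 => x _; rewrite lee_fin sqr_ge0.
have C0 : (0 <= C)%E by apply: integral_ge0 => x _; rewrite lee_fin sqr_ge0.
rewrite -(fineK Gfin) -EFinM.
(* The factor [T] is grouped with the expectations, so that [HV] and [Hrem] apply directly. *)
apply: (@cvge_young _ _ _ _ _ (fun T => (fine G)%:E * (T%:E *
    'E_(P theta)[(fun w => ((thetahat T w - theta) ^+ 2)%R)]))%E
  (fun T => (fine C)%:E * (T%:E *
    'E_(P theta)[(fun w => `|thetahat T w - theta| `^ (2 + 2 * alpha))%R]))%E).
- near=> T.
  have T0 : 0 < T.
    by near: T; apply: cvg_within; exact: nbhs_pinfty_gt.
  have kT : time_set R k T by near: T; exact: withinT.
  have mth := estimator_measurable HX (Hest T kT).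
  have [Tth _] := Hest T kT.
  set A := ('E_(P theta)[_])%E; set B := ('E_(P theta)[_])%E.
  have A0 : (0 <= A)%E by apply: expectation_ge0 => w; exact: sqr_ge0.
  have B0 : (0 <= B)%E by apply: expectation_ge0 => w; exact: powR_ge0.
  have p0 : (0 <= plugin_error (P theta) (mu theta) r (thetahat T) theta)%E.
    apply: integral_ge0 => x _; apply: expectation_ge0 => w; exact: sqr_ge0.
  split=> [|e e0]; first by rewrite mule_ge0// lee_fin ltW.
  have e0' : (0 <= (1 + e)%:E)%E by rewrite lee_fin; lra.
  have e1 : (0 <= (1 + e^-1)%:E)%E by rewrite lee_fin addr_ge0 ?invr_ge0// ltW.
  have [] := plugin_error_young (P theta) (mu theta) HTheta Hrmeas Hrder alpha0
    Hholder mc mdr Ttheta Tth mth e0.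
  have T0' : (0 <= T%:E)%E by rewrite lee_fin ltW.
  rewrite -/G -/C -/A -/B !fineK// => h1 h2; split.
  (* Distributing [T] over the extended sum is legitimate because both summands are nonnegative. *)
  + apply: le_trans (lee_wpmul2l T0' h1) _.
    rewrite ge0_muleDr ?mule_ge0// (muleCA T%:E) (muleCA T%:E G).
    by rewrite (muleCA T%:E _ (C * B)%E) (muleCA T%:E C).
  + rewrite muleCA; apply: le_trans (lee_wpmul2l T0' h2) _.
    rewrite ge0_muleDr ?mule_ge0// (muleCA T%:E).
    by rewrite (muleCA T%:E _ (C * B)%E) (muleCA T%:E C).
- by rewrite EFinM; apply: cvgeZl => //; exact: HV.
- by rewrite -[X in _ --> X](mule0 (fine C)%:E); apply: cvgeZl => //;
    exact: Hrem.
Unshelve. all: by end_near.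
Qed.
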